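(* Let $a,c\in\mathbb R$ with $a^2>c^2$, let $K,\varepsilon_0,h_0>0$, and assume there is $\gamma>0$ with $|\zeta(\varepsilon,i\kappa)|\ge\gamma$ for all real $\kappa$ with $|\kappa|\le K$ and all $0\le\varepsilon\le\varepsilon_0$. Then for $d=i\kappa$, $|\kappa|\le K$, $$\sup_{\substack{0<\varepsilon\le\varepsilon_0\\0<h\le h_0}}h^{-5}\bigl\|\Pi_sS_\varepsilon\Pi_s-e^{hL_\varepsilon}\Pi_s\bigr\|<\infty.$$ Hence, for data in the exact finite-$\varepsilon$ slow eigenspace, applying the base step and projecting back to that eigenspace has a one-step defect $O(h^5)$ with a constant uniform in $\varepsilon/h$: there is $C$ independent of $\varepsilon\in(0,\varepsilon_0]$ and $h\in(0,h_0]$ such that $\|\Pi_sS_\varepsilon U-e^{hL_\varepsilon}U\|\le Ch^5\|U\|$ for every $U\in\operatorname{Ran}\Pi_s$.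
   Context: Jin–Xin Fourier block with $d=i\kappa$: $$A=\begin{pmatrix}0&-d\\-a^2d&0\end{pmatrix},\quad B=\frac1\varepsilon\begin{pmatrix}0&0\\c&-1\end{pmatrix},\quad L_\varepsilon=A+B.$$ $\zeta(\varepsilon,d)=\sqrt{1-4\varepsilon cd+4\varepsilon^2a^2d^2}$, the branch continuous in $\varepsilon$ with $\zeta(0,d)=1$. The slow eigenvalue, a root of $\varepsilon\lambda^2+\lambda+cd-\varepsilon a^2d^2=0$, is $$\lambda_s(\varepsilon,d)=\frac{2(\varepsilon a^2d^2-cd)}{1+\zeta(\varepsilon,d)},$$ and the rank-one slow spectral projector of $L_\varepsilon$ is $$\Pi_s=\frac1\zeta\begin{pmatrix}1+\varepsilon\lambda_s&-\varepsilon d\\c-\varepsilon a^2d&\varepsilon\lambda_s\end{pmatrix}.$$ The base step is $S_\varepsilon=S(h;A,B)$ where, with $L=A+B$, $$P_*=\Bigl(I-\tfrac h2B+\tfrac{h^2}{8}BL\Bigr)^{-1}\Bigl(I+\tfrac h2A+\tfrac{h^2}{8}AL\Bigr),$$ $$S(h;A,B)=\Bigl(I-hB+\tfrac{h^2}{6}BL\Bigr)^{-1}\Bigl[I+hA+\tfrac{h^2}{6}AL+\tfrac{h^2}{3}(A-B)LP_*\Bigr].$$ Norms are a fixed norm on $\mathbb C^2$ and its operator norm. *)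

(* Defs.v *)
From mathcomp Require Import all_boot all_order all_algebra.
From mathcomp Require Import all_classical all_reals all_analysis.
From mathcomp Require Import complex.

Set Implicit Arguments.
Unset Strict Implicit.
Unset Printing Implicit Defensive.

Import Order.TTheory GRing.Theory Num.Theory.
Import numFieldNormedType.Exports.

Local Open Scope classical_set_scope.
Local Open Scope ring_scope.
Local Open Scope complex_scope.

Definition mx2 (K : Type) (p q r s : K) : 'M[K]_2 :=
  \matrix_(i < 2, j < 2)
    if i == 0%N :> nat then (if j == 0%N :> nat then p else q)
    else (if j == 0%N :> nat then r else s).

Definition expmx (K : numFieldType) (n : nat) (X : 'M[K]_n) : 'M[K]_n :=
  limn (series (fun k : nat => k`!%:R^-1 *: X ^+ k)).

Definition is_norm (R : realType) (n : nat) (N : 'cV[R[i]]_n -> R) : Prop :=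
  [/\ forall x, 0 <= N x,
      forall x, N x = 0 -> x = 0,
      forall (z : R[i]) x, N (z *: x) = Normc.normc z * N x
    & forall x y, N (x + y) <= N x + N y].

(* Extended-real valued, so that the supremum is meaningful without a
   boundedness side condition. *)
Definition opnorm (R : realType) (n : nat) (N : 'cV[R[i]]_n -> R)
    (M : 'M[R[i]]_n) : \bar R :=
  ereal_sup [set (N (M *m x))%:E | x in [set x | N x <= 1]].

Definition JX_A (R : realType) (a : R) (d : R[i]) : 'M[R[i]]_2 :=
  mx2 0 (- d) (- (a%:C ^+ 2 * d)) 0.

Definition JX_B (R : realType) (c eps : R) : 'M[R[i]]_2 :=
  eps%:C^-1 *: mx2 0 0 c%:C (- 1).

Definition JX_L (R : realType) (a c eps : R) (d : R[i]) : 'M[R[i]]_2 :=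
  JX_A a d + JX_B c eps.

(* z is the continuous branch on [0, eps0] of
   eps |-> sqrt(1 - 4 eps c d + 4 eps^2 a^2 d^2) with value 1 at eps = 0;
   the alias R[i]^o carries the usual topology of the complex numbers. *)
Definition zeta_branch (R : realType) (a c eps0 : R) (d : R[i])
    (z : R -> R[i]) : Prop :=
  [/\ z 0 = 1,
      forall eps : R, 0 <= eps <= eps0 ->
        z eps ^+ 2 =
          1 - 4 * eps%:C * c%:C * d + 4 * eps%:C ^+ 2 * a%:C ^+ 2 * d ^+ 2
    & {within `[0, eps0], continuous (z : R -> R[i]^o)}].

(* In the next two definitions z stands for the value zeta(eps, d). *)
Definition lambda_s (R : realType) (a c eps : R) (d z : R[i]) : R[i] :=
  2 * (eps%:C * a%:C ^+ 2 * d ^+ 2 - c%:C * d) / (1 + z).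

Definition Pi_s (R : realType) (a c eps : R) (d z : R[i]) : 'M[R[i]]_2 :=
  let l := lambda_s a c eps d z in
  z^-1 *: mx2 (1 + eps%:C * l) (- (eps%:C * d))
              (c%:C - eps%:C * a%:C ^+ 2 * d) (eps%:C * l).

Definition Pstar (R : realType) (n : nat) (h : R) (A B : 'M[R[i]]_n) :
    'M[R[i]]_n :=
  let L := A + B in
  let k := h%:C in
  invmx (1%:M - (k / 2) *: B + (k ^+ 2 / 8) *: (B *m L))
  *m (1%:M + (k / 2) *: A + (k ^+ 2 / 8) *: (A *m L)).

Definition base_step (R : realType) (n : nat) (h : R) (A B : 'M[R[i]]_n) :
    'M[R[i]]_n :=
  let L := A + B in
  let k := h%:C in
  invmx (1%:M - k *: B + (k ^+ 2 / 6) *: (B *m L))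
  *m (1%:M + k *: A + (k ^+ 2 / 6) *: (A *m L)
      + (k ^+ 2 / 3) *: ((A - B) *m L *m Pstar h A B)).

(* Main.v *)
Require Import Defs.
From mathcomp Require Import all_boot all_order all_algebra.
From mathcomp Require Import all_classical all_reals all_analysis.
From mathcomp Require Import complex.
From mathcomp Require Import ring.

Import Order.TTheory GRing.Theory Num.Theory.
Import numFieldNormedType.Exports.
Import Normc.

Local Open Scope classical_set_scope.
Local Open Scope ring_scope.
Local Open Scope complex_scope.

(** The proof rests on an exact formula. Let L = A + B and L U = l U. Since A
U = l U - B U, every occurrence of A in the step can be traded for the scalar l
and for B, and the stages then telescope against the implicit matrices M1 and
M2 that they invert. What remains ([base_step_eigen]) is

  S U = T U + M2^-1 (h^5 l^4 (1/72 - h l/144) B U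
                     - h^6 l^3/192 (A - B) L M1^-1 B U),

where T = sum_(j < 5) (h l)^j / j! is the fourth-order Taylor polynomial of
exp (h l).

On the slow eigenspace l = lambda_s stays bounded as eps -> 0. Let r span that
eigenspace. Then B r = (c l + a^2 d) e2, so the factor 1/eps in B disappears
and the first remainder is O(h^5). The second one contains (A - B) L e2, whose
last entry has order 1/eps^2; when h and eps are comparable it is no better
than O(h^4). Projecting back repairs this. The row eigenvector of Pi_s has its
second entry of order eps, so the projected remainder has order
h^6 / (eps |det M1|) = h^5 x / |det M1| with x = h / eps. Uniformity in x holds
because d = i kappa makes the only non-real term of the determinants purely
imaginary, so that |det M1| >= 1 + x/2 + x^2/8 and |det M2| >= 1 + x + x^2/6
([normc_stage_det]), and all quotients x^j / det with j <= 2 are bounded. Since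
Pi_s has rank one, Pi_s S Pi_s - T Pi_s is a scalar multiple of Pi_s, with
scalar h^5 times [slow_defect], and [ubounded_slow_defect] bounds that factor.

Three further facts finish the proof. The formulas for lambda_s and Pi_s give
spectral data of L when zeta and 1 + zeta do not vanish; in fact Re zeta > 0 on
the whole interval ([zeta_branch_Re_gt0]). As L is l on the range of Pi_s and
-1/eps - l on its kernel, exp (h L) acts on the slow eigenspace as exp (h l)
([expmx_spectral]), which differs from T by at most |h l|^5 exp |h l|
([exp_remainder]). Finally, any norm dominates the coordinates
([coord_le_norm]), so that Pi_s is uniformly bounded and the estimate on the
eigenspace becomes one for the operator norm. *)

(** * The base step on an eigenvector of A + B *)

(** The inner stage is the second-order Taylor value up to h^4: subtracting that
multiple of M1 U from the explicit part leaves a multiple of B U only, and its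
coefficients of order below h^4 cancel. *)
Lemma Pstar_eigen {R : realType} {n : nat} (h : R) (A B : 'M[R[i]]_n)
    (l : R[i]) (U : 'cV[R[i]]_n) (M1 : 'M[R[i]]_n) :
  1%:M - (h%:C / 2) *: B + (h%:C ^+ 2 / 8) *: (B *m (A + B)) = M1 ->
  (A + B) *m U = l *: U -> M1 \in unitmx ->
  Pstar h A B *m U =
    (1 + h%:C * l / 2 + (h%:C * l) ^+ 2 / 8) *: U
    - (h%:C ^+ 4 * l ^+ 3 / 64) *: (invmx M1 *m (B *m U)).
Proof.
move=> M1E LU uM1; rewrite /Pstar M1E -mulmxA; move: h%:C M1E => k M1E.
have AU : A *m U = l *: U - B *m U by rewrite -LU mulmxDl addrK.
have M1U : M1 *m U = U - (k / 2 - k ^+ 2 * l / 8) *: (B *m U).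
  rewrite -M1E !mulmxDl mulNmx mul1mx -!scalemxAl -mulmxA LU -scalemxAr.
  by apply/colP => i; rewrite !mxE; field.
apply: (canLR (mulKmx uM1)).
rewrite mulmxBr -!scalemxAr M1U mulKVmx //.
rewrite !mulmxDl mul1mx -!scalemxAl -mulmxA LU -scalemxAr AU.
by apply/colP => i; rewrite !mxE; field.
Qed.

(** The polynomial factor of U is what the explicit part produces once A U and
(A - B) U are replaced by l U - B U and l U - 2 B U. Subtracting the same
multiple of M2 U again leaves B U alone, now with leading coefficient h^5, and
the error of the inner stage enters with the factor h^2. *)
Lemma base_step_eigen {R : realType} {n : nat} (h : R) (A B : 'M[R[i]]_n)
    (l : R[i]) (U : 'cV[R[i]]_n) (M1 M2 : 'M[R[i]]_n) :
  1%:M - (h%:C / 2) *: B + (h%:C ^+ 2 / 8) *: (B *m (A + B)) = M1 ->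
  1%:M - h%:C *: B + (h%:C ^+ 2 / 6) *: (B *m (A + B)) = M2 ->
  (A + B) *m U = l *: U -> M1 \in unitmx -> M2 \in unitmx ->
  base_step h A B *m U =
    (\sum_(j < 5) (j`!)%:R^-1 * (h%:C * l) ^+ j) *: U
    + invmx M2 *m ((h%:C ^+ 5 * l ^+ 4 * (72^-1 - h%:C * l / 144)) *: (B *m U)
        - (h%:C ^+ 6 * l ^+ 3 / 192) *:
            ((A - B) *m ((A + B) *m (invmx M1 *m (B *m U))))).
Proof.
move=> M1E M2E LU uM1 uM2.
have AU : A *m U = l *: U - B *m U by rewrite -LU mulmxDl addrK.
have DU : (A - B) *m U = l *: U - 2 *: (B *m U).
  by rewrite mulmxDl mulNmx AU -addrA -opprD scaler_nat.
have PU := Pstar_eigen h A B l U M1 M1E LU uM1.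
rewrite /base_step M2E -[LHS]mulmxA.
move: (Pstar h A B) PU => P PU {M1E uM1}.
have M2U : M2 *m U = U - (h%:C - h%:C ^+ 2 * l / 6) *: (B *m U).
  rewrite -M2E !mulmxDl mulNmx mul1mx -!scalemxAl -mulmxA LU -scalemxAr.
  by apply/colP => i; rewrite !mxE; field.
apply: (canLR (mulKmx uM2)).
move: h%:C (A - B) (A + B) {M2E} M2U PU LU DU => k D L M2U PU LU DU.
rewrite mulmxDr -!scalemxAr M2U mulKVmx // !mulmxDl mul1mx -!scalemxAl.
rewrite -!mulmxA PU; move: (invmx M1 *m _) => Y.
rewrite !mulmxBr -!scalemxAr LU -!scalemxAr AU DU; move: (D *m _) => W.
rewrite !big_ord_recr big_ord0 /= !factS fact0.
by apply/colP => i; rewrite !mxE; field.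
Qed.

(** * Two by two matrices *)

Definition cv2 {K : Type} (x y : K) : 'cV[K]_2 :=
  \col_(i < 2) if i == 0%N :> nat then x else y.

Lemma cv2P {K : Type} (x : 'cV[K]_2) : x = cv2 (x ord0 ord0) (x ord_max ord0).
Proof.
apply/colP => i; rewrite mxE; case: i => -[|[|//]] ? /=; congr (x _ _);
  exact: val_inj.
Qed.

Lemma cv2D {K : nmodType} (x y x' y' : K) :
  cv2 x y + cv2 x' y' = cv2 (x + x') (y + y').
Proof. by apply/colP => i; rewrite !mxE; case: ifP. Qed.

Lemma cv2N {K : zmodType} (x y : K) : - cv2 x y = cv2 (- x) (- y).
Proof. by apply/colP => i; rewrite !mxE; case: ifP. Qed.

Lemma cv2Z {K : pzRingType} (t x y : K) : t *: cv2 x y = cv2 (t * x) (t * y).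
Proof. by apply/colP => i; rewrite !mxE; case: ifP. Qed.

Lemma mx2_cv2 {K : pzRingType} (p q r s x y : K) :
  mx2 p q r s *m cv2 x y = cv2 (p * x + q * y) (r * x + s * y).
Proof.
by apply/colP => i; rewrite !mxE big_ord_recl big_ord1 !mxE /=; case: ifP.
Qed.

Lemma mx2Z {K : pzRingType} (t p q r s : K) :
  t *: mx2 p q r s = mx2 (t * p) (t * q) (t * r) (t * s).
Proof. by apply/matrixP => i j; rewrite !mxE; do 2 case: ifP. Qed.

Lemma mx2D {K : nmodType} (p q r s p' q' r' s' : K) :
  mx2 p q r s + mx2 p' q' r' s' = mx2 (p + p') (q + q') (r + r') (s + s').
Proof. by apply/matrixP => i j; rewrite !mxE; do 2 case: ifP. Qed.

Lemma mx2N {K : zmodType} (p q r s : K) :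
  - mx2 p q r s = mx2 (- p) (- q) (- r) (- s).
Proof. by apply/matrixP => i j; rewrite !mxE; do 2 case: ifP. Qed.

Lemma mx2M {K : pzRingType} (p q r s p' q' r' s' : K) :
  mx2 p q r s *m mx2 p' q' r' s' =
  mx2 (p * p' + q * r') (p * q' + q * s') (r * p' + s * r') (r * q' + s * s').
Proof.
by apply/matrixP => i j; rewrite !mxE big_ord_recl big_ord1 !mxE /=;
  do 2 case: ifP.
Qed.

Lemma mx2_1 {K : pzRingType} : 1%:M = mx2 1 0 0 1 :> 'M[K]_2.
Proof. by apply/matrixP => -[[|[|//]] ?] -[[|[|//]] ?]; rewrite !mxE. Qed.

Lemma mulmx_col_inj {K : pzRingType} {m n : nat} (X Y : 'M[K]_(m, n)) :
  (forall x : 'cV_n, X *m x = Y *m x) -> X = Y.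
Proof.
move=> XY; apply/matrixP => i j.
by have /colP/(_ i) := XY (delta_mx j 0); rewrite -!colE !mxE.
Qed.

(** Both implicit matrices of the step have the shape [mx2 1 0 g D], because the
first row of B vanishes ([JX_implicit]); inverting them is one division. *)
Lemma mx2_lower_unit {K : fieldType} (g D : K) :
  D != 0 -> mx2 1 0 g D \in unitmx.
Proof.
move=> D0; apply: (mulmx1_unit (B := mx2 1 0 (- g / D) D^-1) _).1.
by rewrite mx2M mx2_1; congr mx2; field.
Qed.

Lemma mx2_lower_inv {K : fieldType} (g D x y : K) : D != 0 ->
  invmx (mx2 1 0 g D) *m cv2 x y = cv2 x ((y - g * x) / D).
Proof.
move=> D0; apply: (canLR (mulKmx (mx2_lower_unit g D D0))).
by rewrite mx2_cv2; congr cv2; field.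
Qed.

(** * The Jin-Xin block and its slow eigenspace *)

Section JinXin.
Context {R : realType} (a c eps : R) (d : R[i]).
Hypothesis eps_neq0 : eps%:C != 0.
Local Notation A := (JX_A a d).
Local Notation B := (JX_B c eps).
Local Notation L := (JX_L a c eps d).
Local Notation ac := (a%:C).
Local Notation cc := (c%:C).
Local Notation e := (eps%:C).

Lemma JX_B_mx2 : B = mx2 0 0 (cc / e) (- e^-1).
Proof. by rewrite /JX_B mx2Z; congr mx2; field. Qed.

Lemma JX_L_mx2 : L = mx2 0 (- d) (cc / e - ac ^+ 2 * d) (- e^-1).
Proof. by rewrite /JX_L JX_B_mx2 /JX_A mx2D; congr mx2; field. Qed.

Lemma JX_implicit (p q : R[i]) :
  1%:M - p *: B + q *: (B *m L) =
  mx2 1 0 (- (p * cc / e) + q * (ac ^+ 2 * d / e - cc / e ^+ 2))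
          (1 + p / e + q * (e ^- 2 - cc * d / e)).
Proof.
rewrite JX_L_mx2 JX_B_mx2 mx2_1 mx2M !mx2Z mx2N !mx2D.
by congr mx2; field.
Qed.

End JinXin.

Section Slow.
Context {R : realType} (a c eps : R) (d z : R[i]).
Hypothesis eps_neq0 : eps%:C != 0.
Hypothesis z_neq0 : z != 0.
Hypothesis z1_neq0 : 1 + z != 0.
Hypothesis z_sqr : z ^+ 2 =
  1 - 4 * eps%:C * c%:C * d + 4 * eps%:C ^+ 2 * a%:C ^+ 2 * d ^+ 2.
Local Notation A := (JX_A a d).
Local Notation B := (JX_B c eps).
Local Notation L := (JX_L a c eps d).
Local Notation Pi := (Pi_s a c eps d z).
Local Notation l := (lambda_s a c eps d z).
Local Notation ac := (a%:C).
Local Notation cc := (c%:C).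
Local Notation e := (eps%:C).

Let lambda_sM : l * (1 + z) = 2 * (e * ac ^+ 2 * d ^+ 2 - cc * d).
Proof. by rewrite /lambda_s divfK. Qed.

Let two_neq0 : (2 : R[i]) != 0. Proof. by rewrite pnatr_eq0. Qed.

(** With q = eps a^2 d^2 - c d the definition of zeta reads
(zeta - 1) (zeta + 1) = 4 eps q, while lambda_s (1 + zeta) = 2 q; dividing by
1 + zeta makes zeta a polynomial in lambda_s. *)
Lemma zetaE : z = 1 + 2 * e * l.
Proof.
apply: (mulIf z1_neq0); rewrite [RHS]mulrDl -[_ * l * _]mulrA lambda_sM.
have -> : z * (1 + z) = z + z ^+ 2 by ring.
by rewrite z_sqr; ring.
Qed.

Let z1E : 1 + z = 2 * (1 + e * l).
Proof. by rewrite {1}zetaE; ring. Qed.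

Lemma lambda_s_root : l + e * l ^+ 2 = e * ac ^+ 2 * d ^+ 2 - cc * d.
Proof. by apply: (mulfI two_neq0); rewrite -lambda_sM z1E; ring. Qed.

Lemma one_add_eps_lambda_neq0 : 1 + e * l != 0.
Proof. by apply: contraNneq z1_neq0 => l0; rewrite z1E l0 mulr0. Qed.

Let s_neq0 := one_add_eps_lambda_neq0.

Definition slow_vec : 'cV[R[i]]_2 := cv2 (1 + e * l) (cc - e * ac ^+ 2 * d).

(** The linear form phi with [Pi_s x = phi x *: slow_vec]; its kernel is the
fast eigenspace. *)
Definition slow_coord (x : 'cV[R[i]]_2) : R[i] :=
  z^-1 * (x ord0 ord0 - e * d / (1 + e * l) * x ord_max ord0).

Lemma slow_coord_cv2 x y :
  slow_coord (cv2 x y) = z^-1 * (x - e * d / (1 + e * l) * y).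
Proof. by rewrite /slow_coord !mxE. Qed.

Lemma slow_coordD x y : slow_coord (x + y) = slow_coord x + slow_coord y.
Proof. by rewrite /slow_coord !mxE; ring. Qed.

Lemma slow_coordZ t x : slow_coord (t *: x) = t * slow_coord x.
Proof. by rewrite /slow_coord !mxE; ring. Qed.

(** The determinant condition that makes Pi_s of rank one, divided by the entry
[1 + e * l]. *)
Let eigenvec_row :
  e * d / (1 + e * l) * (cc - e * ac ^+ 2 * d) = - (e * l).
Proof.
have -> : e * d / (1 + e * l) * (cc - e * ac ^+ 2 * d) =
  - (e * (e * ac ^+ 2 * d ^+ 2 - cc * d)) / (1 + e * l) by ring.
by rewrite -lambda_s_root; field; exact: s_neq0.
Qed.

Lemma Pi_s_rank_one x : Pi *m x = slow_coord x *: slow_vec.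
Proof.
rewrite (cv2P x) slow_coord_cv2 /Pi_s mx2Z mx2_cv2 /slow_vec cv2Z.
set x0 := x _ _; set x1 := x _ _.
congr cv2; first by field; rewrite s_neq0.
transitivity (z^-1 * ((cc - e * ac ^+ 2 * d) * x0
    - (e * d / (1 + e * l) * (cc - e * ac ^+ 2 * d)) * x1)).
  by rewrite eigenvec_row; ring.
by ring.
Qed.

Lemma slow_coord_slow_vec : slow_coord slow_vec = 1.
Proof.
rewrite slow_coord_cv2 eigenvec_row opprK (_ : _ + _ = z) ?mulVf //.
by rewrite [RHS]zetaE; ring.
Qed.

Lemma Pi_s_slow_vec : Pi *m slow_vec = slow_vec.
Proof. by rewrite Pi_s_rank_one slow_coord_slow_vec scale1r. Qed.

Lemma JX_L_slow_vec : L *m slow_vec = l *: slow_vec.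
Proof.
rewrite /slow_vec JX_L_mx2 // mx2_cv2 cv2Z; congr cv2.
  have -> : l * (1 + e * l) = l + e * l ^+ 2 by ring.
  by rewrite lambda_s_root; ring.
by field.
Qed.

Lemma Pi_s_idem : Pi *m Pi = Pi.
Proof.
apply: mulmx_col_inj => x.
by rewrite -mulmxA !Pi_s_rank_one slow_coordZ slow_coord_slow_vec mulr1.
Qed.

(** The trace of L is -1/eps, so -1/eps - l is the fast eigenvalue; the gap
between the two is zeta/eps. *)
Lemma JX_L_spectral : L = l *: Pi + (- e^-1 - l) *: (1%:M - Pi).
Proof.
have zl : z / e = l - (- e^-1 - l) by rewrite [X in X / _]zetaE; field.
have -> : l *: Pi + (- e^-1 - l) *: (1%:M - Pi) =
    (- e^-1 - l) *: 1%:M + (z / e) *: Pi.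
  by move: (- e^-1 - l) zl => m ->; rewrite scalerBr scalerBl addrCA.
rewrite JX_L_mx2 // mx2_1 /Pi_s !mx2Z mx2D.
by congr mx2; field; rewrite ?z_neq0.
Qed.
End Slow.

(** * The one-step defect as a scalar *)

(** Written in quantities that stay bounded as eps -> 0: the arguments from zV
on stand for 1/zeta, 1/(1 + eps l), 1/det M1, 1/det M2, (h/eps)/det M1, and the
quotient of the lower left entry of -M2 by det M2. A bound then follows by
closure under sums and products. *)
Definition defect_form {K : fieldType}
    (ac cc d e k l zV sV y1 y2 xy1 v : K) : K :=
  (cc * l + ac ^+ 2 * d) * zV *
  (- (l ^+ 4 * (72^-1 - k * l / 144) * (e * d) * sV * y2)
   - l ^+ 3 / 192 *
     (d * xy1
      - d * sV *
        ((e * k * ac ^+ 2 * d ^+ 2 + k * cc * d) * (y1 * y2)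
         - xy1 * y2 + k * d * v * y1))).

Section Defect.
Context {R : realType} (a c eps : R) (d z : R[i]) (h : R).
Hypothesis eps_neq0 : eps%:C != 0.
Hypothesis z_neq0 : z != 0.
Hypothesis z1_neq0 : 1 + z != 0.
Hypothesis z_sqr : z ^+ 2 =
  1 - 4 * eps%:C * c%:C * d + 4 * eps%:C ^+ 2 * a%:C ^+ 2 * d ^+ 2.
Local Notation A := (JX_A a d).
Local Notation B := (JX_B c eps).
Local Notation L := (JX_L a c eps d).
Local Notation l := (lambda_s a c eps d z).
Local Notation ac := (a%:C).
Local Notation cc := (c%:C).
Local Notation e := (eps%:C).
Local Notation k := (h%:C).
Local Notation x := (k / e).

(** The determinant of 1 - p h B + q h^2 B L, as a function of x = h/eps. *)
Definition stage_det (p q : R[i]) : R[i] :=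
  1 + p * x + q * (x ^+ 2 - cc * d * k * x).

(** The opposite of the lower left entry of M2. *)
Definition stage_corner : R[i] := x * (cc + (cc * x - ac ^+ 2 * d * k) / 6).

Local Notation D1 := (stage_det 2^-1 8^-1).
Local Notation D2 := (stage_det 1 6^-1).

Definition slow_defect : R[i] :=
  defect_form ac cc d e k l z^-1 (1 + e * l)^-1 D1^-1 D2^-1
    (x / D1) (stage_corner / D2).

(** The slow coordinate form is applied to [base_step_eigen] at U = slow_vec.
Every negative power of eps is absorbed here: the entry -eps d/(1 + eps l) of
the form meets the entry of order 1/eps^2 in (A - B) L e2, and the factor h/eps
left over is paid for by 1/det M1. *)
Lemma slow_coord_base_step : D1 != 0 -> D2 != 0 ->
  slow_coord a c eps d z (base_step h A B *m slow_vec a c eps d z) =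
  \sum_(j < 5) (j`!)%:R^-1 * (k * l) ^+ j + k ^+ 5 * slow_defect.
Proof.
move=> D1_0 D2_0.
have M1E : 1%:M - (k / 2) *: B + (k ^+ 2 / 8) *: (B *m (A + B)) =
    mx2 1 0 (- (k / 2 * cc / e) + k ^+ 2 / 8 * (ac ^+ 2 * d / e - cc / e ^+ 2))
      D1.
  by rewrite [LHS]JX_implicit //; congr mx2; rewrite /stage_det; field.
have M2E : 1%:M - k *: B + (k ^+ 2 / 6) *: (B *m (A + B)) =
    mx2 1 0 (- stage_corner) D2.
  rewrite [LHS]JX_implicit //.
  by congr mx2; rewrite /stage_det /stage_corner; field.
have Lr := JX_L_slow_vec a c eps d z eps_neq0 z1_neq0 z_sqr.
have s0 := one_add_eps_lambda_neq0 a c eps d z z1_neq0 z_sqr.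
rewrite (base_step_eigen _ _ _ _ _ _ _ M1E M2E Lr); try exact: mx2_lower_unit.
rewrite -/(JX_L a c eps d).
rewrite slow_coordD slow_coordZ slow_coord_slow_vec // mulr1; congr (_ + _).
have Br : B *m slow_vec a c eps d z = cv2 0 (cc * l + ac ^+ 2 * d).
  by rewrite JX_B_mx2 // mx2_cv2; congr cv2; field.
rewrite Br mx2_lower_inv // JX_L_mx2 // mx2_cv2 JX_B_mx2 // /JX_A mx2N mx2D.
rewrite mx2_cv2 !cv2Z cv2N cv2D mx2_lower_inv // slow_coord_cv2.
rewrite /slow_defect /defect_form.
move: D1_0 D2_0; move: D1 D2 stage_corner => y1 y2 v y1_0 y2_0.
move: l s0 => t s0.
by field; apply/and5P.
Qed.
End Defect.

(** * Uniform bounds in the stiffness ratio *)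

Lemma normc_ge0 {R : rcfType} (z : R[i]) : 0 <= normc z.
Proof. by case: z => x y; exact: sqrtr_ge0. Qed.

Lemma normc_ge_absRe {R : rcfType} (z : R[i]) : `|complex.Re z| <= normc z.
Proof.
by case: z => x y /=; rewrite -sqrtr_sqr ler_wsqrtr // lerDl sqr_ge0.
Qed.

Lemma normc_real {R : rcfType} (x : R) : normc x%:C = `|x|.
Proof. by rewrite /= expr0n /= addr0 sqrtr_sqr. Qed.

Lemma normcX {R : rcfType} (z : R[i]) m : normc (z ^+ m) = normc z ^+ m.
Proof.
by elim: m => [|m IH]; rewrite ?expr0 ?normc1 // !exprS normcM IH.
Qed.

Lemma natrV_complex {R : rcfType} n : (n%:R^-1 : R[i]) = ((n%:R^-1 : R))%:C.
Proof. by rewrite fmorphV rmorph_nat. Qed.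

Section UniformBound.
Context {K : numFieldType} {T : Type} (D : set T).

(** Boundedness uniform in all parameters of the problem, kept existential so
that no explicit constants have to be carried along. *)
Definition ubounded (f : T -> K) : Prop :=
  exists C : K, forall t, D t -> `|f t| <= C.

Lemma ubounded_ext f g :
  (forall t, D t -> f t = g t) -> ubounded g -> ubounded f.
Proof. by move=> fg [C gC]; exists C => t Dt; rewrite fg // gC. Qed.

Lemma ubounded_cst z : ubounded (fun=> z).
Proof. by exists `|z|. Qed.

Lemma uboundedD f g : ubounded f -> ubounded g -> ubounded (fun t => f t + g t).
Proof.
move=> [C fC] [C' gC]; exists (C + C') => t Dt.
by apply: le_trans (ler_normD _ _) _; rewrite lerD ?fC ?gC.
Qed.

Lemma uboundedN f : ubounded f -> ubounded (fun t => - f t).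
Proof. by move=> [C fC]; exists C => t Dt; rewrite normrN fC. Qed.

Lemma uboundedM f g : ubounded f -> ubounded g -> ubounded (fun t => f t * g t).
Proof.
move=> [C fC] [C' gC]; exists (C * C') => t Dt.
by rewrite normrM ler_pM ?fC ?gC.
Qed.

Lemma uboundedX f m : ubounded f -> ubounded (fun t => f t ^+ m).
Proof.
move=> [C fC]; exists (C ^+ m) => t Dt.
by rewrite normrX lerXn2r ?nnegrE ?(le_trans _ (fC _ Dt)) ?fC.
Qed.
End UniformBound.

(** Closure under the ring operations reduces a uniform bound for an expression
to the bounds for its atoms that are in the context. *)
Ltac ubound := repeat match goal with
  | |- ubounded _ (fun=> _) => refine (ubounded_cst _ _)
  | H : ubounded _ ?f |- ubounded _ ?g => constr_eq f g; exact H
  | |- ubounded _ (fun t => - @?f t) => refine (uboundedN _ f _)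
  | |- ubounded _ (fun t => @?f t + @?g t) => refine (uboundedD _ f g _ _)
  | |- ubounded _ (fun t => @?f t ^+ _) => refine (uboundedX _ f _ _)
  | |- ubounded _ (fun t => @?f t * @?g t) => refine (uboundedM _ f g _ _)
  end.

Lemma ubounded_defect_form {K : numFieldType} {T : Type} (D : set T)
    (ac cc d : K) (e k l zV sV y1 y2 xy1 v : T -> K) :
  ubounded D e -> ubounded D k -> ubounded D l -> ubounded D zV ->
  ubounded D sV -> ubounded D y1 -> ubounded D y2 -> ubounded D xy1 ->
  ubounded D v ->
  ubounded D (fun t => defect_form ac cc d (e t) (k t) (l t) (zV t) (sV t)
    (y1 t) (y2 t) (xy1 t) (v t)).
Proof. by move=> *; rewrite /defect_form; ubound. Qed.

Lemma ubounded_normc {R : rcfType} {T : Type} (D : set T) (f : T -> R[i]) :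
  ubounded D f <-> exists C : R, forall t, D t -> normc (f t) <= C.
Proof.
split=> -[C fC].
  exists (complex.Re C) => t /fC.
  by rewrite lecE normc_def => /andP[_] /=; case: (f t).
exists C%:C => t /fC; rewrite normc_def lecR.
by case: (f t).
Qed.

Section StageBounds.
Context {R : realType} (c eps kappa h p q : R).
Hypotheses (eps_gt0 : 0 < eps) (h_gt0 : 0 < h) (p_gt0 : 0 < p) (q_gt0 : 0 < q).
Local Notation y := (h / eps).
Local Notation D := (stage_det c eps (0 +i* kappa) h p%:C q%:C).

Let y_gt0 : 0 < y. Proof. exact: divr_gt0. Qed.

(** The real part of the determinant is the left-hand side: with p and q real,
d = i kappa only enters through the imaginary term q c d h x. *)
Lemma normc_stage_det : 1 + p * y + q * y ^+ 2 <= normc D.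
Proof.
apply: le_trans (normc_ge_absRe _); apply: le_trans (ler_norm _).
have -> : D = (1 + p * y + q * y ^+ 2)%:C - (q * c * h * y)%:C * (0 +i* kappa).
  rewrite /stage_det !(rmorphD, rmorphM, rmorphXn, fmorphV, rmorph1) /=; ring.
by rewrite /= !mulr0 mul0r !subr0.
Qed.

Lemma stage_det_neq0 : D != 0.
Proof.
apply: contraTneq normc_stage_det => ->; rewrite normc0 -ltNge.
by rewrite -addrA ltr_pwDl // addr_ge0 // mulr_ge0 ?sqr_ge0 // ltW.
Qed.

Let quot_le (u C : R) : 0 <= u -> u <= C * (1 + p * y + q * y ^+ 2) ->
  0 <= C -> normc (u%:C / D) <= C.
Proof.
move=> u0 uC C0; rewrite normcM normcV normc_real ger0_norm //.
rewrite ler_pdivrMr; last first.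
  rewrite lt_neqAle normc_ge0 andbT eq_sym.
  by apply: contra_neq stage_det_neq0 => /eq0_normc.
by apply: le_trans uC _; rewrite ler_wpM2l // normc_stage_det.
Qed.

Lemma normc_stage_det_inv : normc D^-1 <= 1.
Proof.
rewrite -[D^-1]mul1r (_ : 1 = 1%:C) //; apply: quot_le => //; rewrite mul1r.
by rewrite -addrA lerDl addr_ge0 // mulr_ge0 ?sqr_ge0 // ltW.
Qed.

Lemma normc_ratio_stage_det : normc (h%:C / eps%:C / D) <= p^-1.
Proof.
rewrite -fmorph_div; apply: quot_le; [exact: ltW| |by rewrite invr_ge0 ltW].
rewrite ler_pdivlMl // addrAC lerDr.
by rewrite addr_ge0 // mulr_ge0 ?sqr_ge0 // ltW.
Qed.

Lemma normc_sqr_ratio_stage_det : normc ((h%:C / eps%:C) ^+ 2 / D) <= q^-1.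
Proof.
rewrite -fmorph_div -rmorphXn.
apply: quot_le; [exact: sqr_ge0| |by rewrite invr_ge0 ltW].
rewrite ler_pdivlMl // lerDr.
by rewrite addr_ge0 // mulr_ge0 ?sqr_ge0 // ltW.
Qed.
End StageBounds.

Section UniformDefect.
Context {R : realType} (a c kappa eps0 h0 gamma : R) (z : R -> R[i]).
Local Notation d := (0 +i* kappa : R[i]).
Hypothesis gamma_gt0 : 0 < gamma.
Hypothesis z_ge : forall eps, 0 < eps <= eps0 -> gamma <= normc (z eps).
Hypothesis z_Re : forall eps, 0 < eps <= eps0 -> 0 < complex.Re (z eps).
Hypothesis z_sqr : forall eps, 0 < eps <= eps0 -> z eps ^+ 2 =
  1 - 4 * eps%:C * c%:C * d + 4 * eps%:C ^+ 2 * a%:C ^+ 2 * d ^+ 2.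

Definition regime : set (R * R) :=
  [set t | 0 < t.1 <= eps0 /\ 0 < t.2 <= h0].

Let epsb : ubounded regime (fun t => t.1%:C).
Proof.
apply/ubounded_normc; exists eps0 => t [/andP[e0 eE] _].
by rewrite (normc_real t.1) gtr0_norm.
Qed.

Let hb : ubounded regime (fun t => t.2%:C).
Proof.
apply/ubounded_normc; exists h0 => t [_ /andP[h_gt0 hE]].
by rewrite (normc_real t.2) gtr0_norm.
Qed.

Let zVb : ubounded regime (fun t => (z t.1)^-1).
Proof.
apply/ubounded_normc; exists gamma^-1 => -[e h] [/z_ge zg _].
rewrite normcV lef_pV2 ?posrE //.
exact: lt_le_trans zg.
Qed.

Let normc_1z t : regime t -> 1 <= normc (1 + z t.1).
Proof.
move=> [/z_Re zR _]; apply: le_trans (normc_ge_absRe _).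
apply: le_trans (ler_norm _); rewrite raddfD /= lerDl; exact: ltW.
Qed.

Let z1_neq0 t : regime t -> 1 + z t.1 != 0.
Proof.
by move=> Dt; apply: contraTneq (normc_1z t Dt) => ->; rewrite normc0 -ltNge.
Qed.

Let z1Vb : ubounded regime (fun t => (1 + z t.1)^-1).
Proof.
apply/ubounded_normc; exists 1 => t /normc_1z z1.
by rewrite normcV invf_le1 // (lt_le_trans ltr01).
Qed.

Local Notation l t := (lambda_s a c t.1 d (z t.1)).

(** This is where Re zeta > 0 matters: it keeps 1 + zeta away from 0, also where
zeta is not close to its value 1 at eps = 0. *)
Lemma ubounded_lambda_s : ubounded regime (fun t => l t).
Proof.
rewrite /lambda_s; apply: uboundedM z1Vb.
apply: uboundedM (ubounded_cst _ _) _.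
apply: uboundedD (uboundedN _ _ (ubounded_cst _ _)).
do 2 apply: uboundedM (ubounded_cst _ _).
exact: epsb.
Qed.

Let eps_neq0 t : regime t -> t.1%:C != 0.
Proof.
case=> /andP[e0 _] _.
by rewrite (fmorph_eq0 (real_complex R)) gt_eqF.
Qed.

Let sVb : ubounded regime (fun t => (1 + t.1%:C * l t)^-1).
Proof.
have /ubounded_ext : forall t, regime t ->
    (1 + t.1%:C * l t)^-1 = 2 * (1 + z t.1)^-1.
  move=> t Dt; have [zt _] := Dt.
  have zE := zetaE a c t.1 d (z t.1) (z1_neq0 t Dt) (z_sqr _ zt).
  have s0 :=
    one_add_eps_lambda_neq0 a c t.1 d (z t.1) (z1_neq0 t Dt) (z_sqr _ zt).
  have -> : 1 + z t.1 = 2 * (1 + t.1%:C * l t) by rewrite {1}zE; ring.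
  by field.
by apply; apply: uboundedM (ubounded_cst _ _) z1Vb.
Qed.

Local Notation D1 t := (stage_det c t.1 d t.2 2^-1 8^-1).
Local Notation D2 t := (stage_det c t.1 d t.2 1 6^-1).
Local Notation x t := (t.2%:C / t.1%:C).

Let D1Vb : ubounded regime (fun t => (D1 t)^-1).
Proof.
apply/ubounded_normc; exists 1 => t [/andP[e0 _] /andP[h_gt0 _]].
rewrite !natrV_complex.
by apply: normc_stage_det_inv; rewrite ?invr_gt0.
Qed.

Let D2Vb : ubounded regime (fun t => (D2 t)^-1).
Proof.
apply/ubounded_normc; exists 1 => t [/andP[e0 _] /andP[h_gt0 _]].
rewrite natrV_complex.
by apply: normc_stage_det_inv; rewrite ?invr_gt0.
Qed.

Let xD1b : ubounded regime (fun t => x t / D1 t).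
Proof.
apply/ubounded_normc; exists (2^-1)^-1 => t [/andP[e0 _] /andP[h_gt0 _]].
rewrite !natrV_complex.
by apply: normc_ratio_stage_det; rewrite ?invr_gt0.
Qed.

Let xD2b : ubounded regime (fun t => x t / D2 t).
Proof.
apply/ubounded_normc; exists 1^-1 => t [/andP[e0 _] /andP[h_gt0 _]].
rewrite natrV_complex.
by apply: normc_ratio_stage_det; rewrite ?invr_gt0.
Qed.

Let x2D2b : ubounded regime (fun t => x t ^+ 2 / D2 t).
Proof.
apply/ubounded_normc; exists 6^-1^-1 => t [/andP[e0 _] /andP[h_gt0 _]].
rewrite natrV_complex.
by apply: normc_sqr_ratio_stage_det; rewrite ?invr_gt0.
Qed.

Let cornerD2b : ubounded regime (fun t => stage_corner a c t.1 d t.2 / D2 t).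
Proof.
have /ubounded_ext : forall t, regime t -> stage_corner a c t.1 d t.2 / D2 t =
    c%:C * (x t / D2 t) + (c%:C * (x t ^+ 2 / D2 t)
      - a%:C ^+ 2 * d * (t.2%:C * (x t / D2 t))) * 6^-1.
  by move=> t _; rewrite /stage_corner; ring.
apply; apply: uboundedD; first exact: uboundedM (ubounded_cst _ _) xD2b.
apply: uboundedM (ubounded_cst _ _).
apply: uboundedD; first exact: uboundedM (ubounded_cst _ _) x2D2b.
apply: uboundedN; apply: uboundedM (ubounded_cst _ _) _.
exact: uboundedM hb xD2b.
Qed.

Lemma ubounded_slow_defect :
  ubounded regime (fun t => slow_defect a c t.1 d (z t.1) t.2).
Proof. exact: ubounded_defect_form ubounded_lambda_s _ _ _ _ _ _. Qed.

Lemma ubounded_Pi_s i j :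
  ubounded regime (fun t => Pi_s a c t.1 d (z t.1) i j).
Proof.
have lb := ubounded_lambda_s.
have /ubounded_ext : forall t, regime t ->
    Pi_s a c t.1 d (z t.1) i j = (z t.1)^-1 *
    if i == 0%N :> nat
    then if j == 0%N :> nat then 1 + t.1%:C * l t else - (t.1%:C * d)
    else if j == 0%N :> nat then c%:C - t.1%:C * a%:C ^+ 2 * d
         else t.1%:C * l t.
  by move=> t _; rewrite !mxE.
apply; apply: uboundedM zVb _.
by case: (i == 0%N :> nat); case: (j == 0%N :> nat); ubound.
Qed.

End UniformDefect.

(** * The exponential of a matrix with two spectral projectors *)

Definition exp_terms {K : numFieldType} (z : K) : nat -> K :=
  fun k => (k`!)%:R^-1 * z ^+ k.

Lemma spectral_exp {K : numFieldType} {n : nat} (P : 'M[K]_n) (x y : K) k :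
  P *m P = P ->
  (x *: P + y *: (1%:M - P)) ^+ k = x ^+ k *: P + y ^+ k *: (1%:M - P).
Proof.
move=> PP.
have PQ : P *m (1%:M - P) = 0 by rewrite mulmxBr mulmx1 PP subrr.
have QP : (1%:M - P) *m P = 0 by rewrite mulmxBl mul1mx PP subrr.
have QQ : (1%:M - P) *m (1%:M - P) = 1%:M - P.
  by rewrite mulmxBr mulmx1 QP subr0.
elim: k => [|k IH]; first by rewrite !expr0 !scale1r addrC subrK.
rewrite exprS IH -[_ * _]/(_ *m _).
move: (1%:M - P) PQ QP QQ {IH} => Q PQ QP QQ.
rewrite mulmxDl !mulmxDr -!scalemxAl -!scalemxAr PP PQ QP QQ !scaler0.
by rewrite addr0 add0r !scalerA -!exprS.
Qed.

(** The matrix exponential is a limit of partial sums; on complementary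
projectors these split into two scalar series, so the convergence of the matrix
series comes for free from that of the scalar ones. *)
Lemma expmx_spectral {K : numFieldType} {n : nat} (P : 'M[K]_n)
    (x y ex ey : K) :
  P *m P = P ->
  series (exp_terms x) @ \oo --> ex -> series (exp_terms y) @ \oo --> ey ->
  expmx (x *: P + y *: (1%:M - P)) = ex *: P + ey *: (1%:M - P).
Proof.
move=> PP cx cy; rewrite /expmx; apply: cvg_lim; first exact: norm_hausdorff.
have -> : series (fun k => k`!%:R^-1 *: (x *: P + y *: (1%:M - P)) ^+ k) =
  (fun m => series (exp_terms x) m *: P + series (exp_terms y) m *: (1%:M - P)).
  apply/funext => m; rewrite /series /= !scaler_suml -big_split /=.
  by apply: eq_bigr => k _; rewrite spectral_exp // scalerDr !scalerA.
by apply: cvgD; apply: cvgZr_tmp.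
Qed.

Lemma normc_ge_absIm {R : rcfType} (z : R[i]) : `|complex.Im z| <= normc z.
Proof.
by case: z => x y /=; rewrite -sqrtr_sqr ler_wsqrtr // lerDr sqr_ge0.
Qed.

Lemma normc_le_abs {R : rcfType} (z : R[i]) :
  normc z <= `|complex.Re z| + `|complex.Im z|.
Proof.
case: z => x y /=; rewrite -[leRHS]ger0_norm ?addr_ge0 // -[leRHS]sqrtr_sqr.
rewrite ler_wsqrtr // sqrrD !real_normK ?num_real // addrAC lerDl.
by rewrite mulrn_wge0 // mulr_ge0.
Qed.

Lemma normc_exp_terms {R : realType} (z : R[i]) k :
  normc (exp_terms z k) = exp_coeff (normc z) k.
Proof.
rewrite /exp_terms /exp_coeff /= normcM normcV normcX mulrC.
by rewrite -(rmorph_nat (real_complex R)) normc_real normr_nat.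
Qed.

Lemma norm_normc {R : rcfType} (z : R[i]) : `|z| = (normc z)%:C.
Proof. by rewrite normc_def; case: z. Qed.

(** Convergence is reduced to the real exponential series, which dominates the
real and the imaginary parts. *)
Lemma cvg_series_exp_terms {R : realType} (z : R[i]) :
  exists w : R[i], series (exp_terms z) @ \oo --> (w : R[i]^o).
Proof.
have part (f : R[i] -> R) : (forall x, `|f x| <= normc x) ->
    cvgn (series (f \o exp_terms z)).
  move=> fn; apply: normed_cvg.
  apply: series_le_cvg (is_cvg_series_exp_coeff (normc z)).
  - by move=> k /=.
  - by move=> k; rewrite exp_coeff_ge0 // normc_ge0.
  - by move=> k /=; rewrite -normc_exp_terms.
have /cvg_ex[u /cvgrPdist_lt cu] := part (@complex.Re R) normc_ge_absRe.
have /cvg_ex[v /cvgrPdist_lt cv] := part (@complex.Im R) normc_ge_absIm.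
exists (u +i* v); apply/cvgrPdist_lt => e.
rewrite ltcE /= => /andP[/eqP e_im e_gt0].
have e2 : 0 < complex.Re e / 2 by rewrite divr_gt0.
near=> m.
rewrite norm_normc ltcE /= e_im eqxx /=.
apply: le_lt_trans (normc_le_abs _) _.
rewrite [ltRHS]splitr; apply: ltrD.
  rewrite raddfB /=.
  rewrite (_ : complex.Re _ = series (@complex.Re R \o exp_terms z) m).
    by near: m; exact: cu.
  by rewrite /series /= raddf_sum.
rewrite raddfB /=.
rewrite (_ : complex.Im _ = series (@complex.Im R \o exp_terms z) m).
  by near: m; exact: cv.
by rewrite /series /= raddf_sum.
Unshelve. all: by end_near. Qed.

(** Since (k + m)! >= k!, a tail of the series is at most |z|^m times a partial
sum of exp |z|; the bound passes to the limit. *)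
Lemma exp_remainder {R : realType} (z w : R[i]) m :
  series (exp_terms z) @ \oo --> (w : R[i]^o) ->
  normc (w - \sum_(k < m) exp_terms z k) <= normc z ^+ m * expR (normc z).
Proof.
move=> zw; set C := (_ * _).
have tail n : normc (\sum_(m <= k < n + m) exp_terms z k) <= C.
  apply: (@le_trans _ _ (\sum_(m <= k < n + m) normc (exp_terms z k))).
    elim/big_ind2 : _ => //; first by rewrite normc0.
    by move=> x1 x2 y1 y2 h1 h2; apply: le_trans (le_normcD _ _) (lerD h1 h2).
  rewrite -{1}[m]add0n big_addn addnK.
  apply: (@le_trans _ _ (normc z ^+ m * series (exp_coeff (normc z)) n)).
    rewrite /series /= mulr_sumr; apply: ler_sum => k _.
    rewrite normc_exp_terms /exp_coeff /= exprD [_ ^+ k * _]mulrC -mulrA.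
    do 2! [apply: ler_wpM2l; first by rewrite exprn_ge0 ?normc_ge0].
    by rewrite lef_pV2 ?posrE ?ltr0n ?fact_gt0 // ler_nat leq_fact // leq_addr.
  rewrite ler_wpM2l ?exprn_ge0 ?normc_ge0 // /expR.
  apply: nondecreasing_cvgn_le; last exact: is_cvg_series_exp_coeff.
  by apply: nondecreasing_series => k _ _; rewrite exp_coeff_ge0 ?normc_ge0.
(* Otherwise the partial sums would stay away from w by the amount of excess. *)
rewrite leNgt; apply/negP => Cw.
have /cvgrPdist_lt := zw.
move=> /(_ (normc (w - \sum_(k < m) exp_terms z k) - C)%:C).
rewrite ltcR subr_gt0 => /(_ Cw) [N _ /(_ (N + m)%N)] /=.
rewrite leq_addr norm_normc ltcR => /(_ isT).
rewrite ltrBrDr ltNge => /negP; apply.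
apply: le_trans (lerD (lexx _) (tail N)).
apply: le_trans (le_normcD _ _).
rewrite /series /= (@big_cat_nat _ _ _ m) /= ?leq_addl // big_mkord.
by rewrite opprD addrA subrK.
Qed.

(** * Norms on complex column vectors *)

Section NormEquivalence.
Context {R : realType} {n : nat} (N : 'cV[R[i]]_n -> R).
Hypothesis hN : is_norm N.

Lemma is_norm_ge0 x : 0 <= N x. Proof. by case: hN. Qed.

Lemma is_normZ z x : N (z *: x) = normc z * N x. Proof. by case: hN. Qed.

Lemma is_normD x y : N (x + y) <= N x + N y. Proof. by case: hN. Qed.

Lemma is_norm0 : N 0 = 0.
Proof. by rewrite -(scale0r (0 : 'cV_n)) is_normZ normc0 mul0r. Qed.

Lemma is_normN x : N (- x) = N x.
Proof. by rewrite -scaleN1r is_normZ normcN normc1 mul1r. Qed.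

Lemma is_norm_dist x y : `|N x - N y| <= N (x - y).
Proof.
have key u v : N u - N v <= N (u - v).
  by rewrite lerBlDr -{1}[u](subrK v) is_normD.
by rewrite ler_norml key andbT lerNl opprB -[leRHS]is_normN opprB key.
Qed.

Lemma is_norm_le_coord x :
  N x <= \sum_i normc (x i ord0) * N (delta_mx i ord0).
Proof.
have {1}-> : x = \sum_i x i ord0 *: delta_mx i ord0.
  by rewrite {1}[x]matrix_sum_delta; apply: eq_bigr => i _; rewrite big_ord1.
elim/big_ind2 : _ => [|x1 x2 y1 y2 h1 h2|i _]; first by rewrite is_norm0.
  by apply: le_trans (is_normD _ _) (lerD h1 h2).
by rewrite is_normZ.
Qed.

(** Complex columns as real rows of twice the length, to which the Heine-Borel
theorem applies. *)
Definition cplx_col (v : 'rV[R]_(n + n)) : 'cV[R[i]]_n :=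
  \col_i (v ord0 (lshift n i) +i* v ord0 (rshift n i)).

Lemma cplx_colB v w : cplx_col (v - w) = cplx_col v - cplx_col w.
Proof. by apply/colP => i; rewrite !mxE. Qed.

Lemma cplx_colZ r v : cplx_col (r *: v) = r%:C *: cplx_col v.
Proof. by apply/colP => i; rewrite !mxE; simpc. Qed.

Lemma rV_entry_le_norm m (v : 'rV[R]_m) j : `|v ord0 j| <= `|v|.
Proof.
rewrite [leRHS]/Num.norm /= mx_normrE.
exact: (le_bigmax _ (fun ij => `|v ij.1 ij.2|) (ord0, j)).
Qed.

Lemma normc_cplx_col v i : normc (cplx_col v i ord0) <= 2 * `|v|.
Proof.
rewrite mxE mulr_natl mulr2n; apply: le_trans (normc_le_abs _) _ => /=.
by rewrite lerD // rV_entry_le_norm.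
Qed.

Lemma continuous_norm_cplx_col : continuous (N \o cplx_col).
Proof.
pose M := 1 + \sum_i N (delta_mx i ord0) * 2.
have M0 : 0 < M.
  by rewrite ltr_pwDl // sumr_ge0 // => i _; rewrite mulr_ge0 ?is_norm_ge0.
move=> v; have Fv := @nbhs_filter _ v.
apply/cvgrPdist_lt => e e0.
apply/(@nbhs_normP R 'rV[R]_(n + n)); exists (e / M); first exact: divr_gt0.
move=> w /=; rewrite ltr_pdivlMr // => /(le_lt_trans _); apply => /=.
apply: le_trans (is_norm_dist _ _) _; rewrite -cplx_colB.
apply: le_trans (is_norm_le_coord _) _.
rewrite /M mulrDr mulr1 ler_wpDl // mulr_sumr.
apply: ler_sum => i _; rewrite mulrC [leRHS]mulrCA.
by rewrite ler_wpM2l ?is_norm_ge0 // mulrC normc_cplx_col.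
Qed.

(** Any norm is continuous, hence attains its minimum on the compact unit sphere
of the sup norm, and vanishes nowhere on it. *)
Lemma norm_cplx_col_sphere : exists2 delta, 0 < delta &
  forall v, `|v| = 1 -> delta <= N (cplx_col v).
Proof.
pose S := [set v : 'rV[R]_(n + n) | `|v| = 1].
have [S0|S0] := pselect (S !=set0); last first.
  by exists 1 => // v v1; exfalso; apply: S0; exists v.
have cS : compact S.
  apply: bounded_closed_compact.
    exists 1; split; first exact: num_real.
    by move=> x x1 v /= ->; exact: ltW.
  apply: (@closed_comp _ _ (fun v : 'rV[R]_(n + n) => `|v|) [set 1]).
    by move=> v _; exact: norm_continuous.
  exact: closed_eq.
have cf : {within S, continuous (N \o cplx_col)}.
  exact: continuous_subspaceT continuous_norm_cplx_col.
have [v vS vmin] := EVT_min_rV S0 cS cf.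
exists (N (cplx_col v)); last by move=> w w1; apply: vmin; rewrite inE.
rewrite lt_neqAle is_norm_ge0 andbT; apply/eqP => /esym Nv0.
have v0 : v = 0.
  have /colP vc : cplx_col v = 0 by case: hN => _ + _ _; exact.
  apply/rowP => j; rewrite mxE -[j]fintype.splitK.
  by case: (fintype.split j) => i /=;
    have := vc i; rewrite !mxE => -[].
move: vS; rewrite inE /S /= v0 normr0 => /eqP.
by rewrite eq_sym oner_eq0.
Qed.

(** Equivalence of norms in finite dimension, in the direction that needs
compactness; the other one is [is_norm_le_coord]. *)
Lemma coord_le_norm : exists2 C, 0 <= C &
  forall (x : 'cV[R[i]]_n) i, normc (x i ord0) <= C * N x.
Proof.
have [delta d0 dmin] := norm_cplx_col_sphere.
exists (2 / delta) => [|x i]; first by rewrite divr_ge0 // ltW.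
pose v : 'rV[R]_(n + n) :=
  row_mx (\row_j complex.Re (x j ord0)) (\row_j complex.Im (x j ord0)).
have xE : cplx_col v = x.
  apply/colP => j; rewrite mxE row_mxEl row_mxEr !mxE.
  by case: (x j ord0).
rewrite -xE; apply: le_trans (normc_cplx_col _ _) _.
rewrite -mulrA ler_wpM2l // ler_pdivlMl //.
have [->|v0] := eqVneq v 0; first by rewrite normr0 mulr0 is_norm_ge0.
have v_gt0 : 0 < `|v| by rewrite normr_gt0.
have v1 : `| `|v|^-1 *: v| = 1.
  by rewrite normrZ normfV normr_id mulVf // gt_eqF.
have := dmin _ v1; rewrite cplx_colZ is_normZ normc_real normfV normr_id.
by rewrite ler_pdivlMl // mulrC.
Qed.
End NormEquivalence.

(** * The branch of the square root *)

Lemma continuous_Re {R : realType} : continuous (@complex.Re R : R[i]^o -> R).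
Proof.
move=> z; have Fz := @nbhs_filter R[i]^o z.
apply/cvgrPdist_lt => e e0.
apply/(@nbhs_normP _ R[i]^o); exists e%:C; first by rewrite /= ltcR.
move=> w /=; rewrite norm_normc ltcR; apply: le_lt_trans.
by rewrite -raddfB; exact: normc_ge_absRe.
Qed.

Lemma zeta_sqr_parts {R : realType} (a c kappa eps : R) :
  1 - 4 * eps%:C * c%:C * (0 +i* kappa)
    + 4 * eps%:C ^+ 2 * a%:C ^+ 2 * (0 +i* kappa) ^+ 2 =
  (1 - (2 * eps * `|a * kappa|) ^+ 2) +i* (- (4 * eps * c * kappa)) :> R[i].
Proof.
rewrite exprMn real_normK ?num_real //.
by apply/eqP; rewrite eq_complex /=; apply/andP; split; apply/eqP; ring.
Qed.

(** Re zeta starts at 1, so if it were not positive it would vanish at some e1.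
There zeta^2 is a real number <= 0: its real part gives 2 e1 |a kappa| >= 1, so
that e1 and kappa are not 0, and its imaginary part - 4 e1 c kappa = 0 leaves
c = 0. But then zeta^2 = 1 - (2 eps |a kappa|)^2 vanishes at eps = 1/(2 |a kappa|) <= e1, which
the lower bound on |zeta| excludes. *)
Lemma zeta_branch_Re_gt0 {R : realType} (a c eps0 kappa gamma : R)
    (z : R -> R[i]) :
  zeta_branch a c eps0 (0 +i* kappa) z -> 0 < gamma ->
  (forall eps, 0 <= eps <= eps0 -> gamma <= normc (z eps)) ->
  forall eps, 0 <= eps <= eps0 -> 0 < complex.Re (z eps).
Proof.
move=> [z0 z_sqr z_cont] gamma_gt0 z_ge eps /andP[eps_ge0 eps_le].
rewrite ltNge; apply/negP => Re_le0.
have cRe : {within `[0, eps], continuous (@complex.Re R \o z)}.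
  have : {within `[0, eps], continuous (z : R -> R[i]^o)}.
    apply: continuous_subspaceW z_cont => x /=; rewrite !in_itv /=.
    by move=> /andP[-> /le_trans]; apply.
  by move=> zc x; exact: cvg_comp (zc x) (continuous_Re (z x)).
have [|e1] := IVT eps_ge0 cRe (v := 0).
  by rewrite /= z0 ge_min le_max Re_le0 ler01 orbT.
rewrite in_itv /= => /andP[e1_ge0 e1_le] Re0.
have e1_eps0 : 0 <= e1 <= eps0 by rewrite e1_ge0 (le_trans e1_le).
have := z_sqr e1 e1_eps0; rewrite zeta_sqr_parts.
case: (z e1) Re0 => x y /= -> /eqP.
rewrite eq_complex /= => /andP[/eqP zRe /eqP zIm].
set w := `|a * kappa| in zRe.
have w_ge0 : 0 <= w by exact: normr_ge0.
have e1w : 1 <= 2 * e1 * w.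
  rewrite -(@ler_pXn2r _ 2) ?nnegrE ?mulr_ge0 // expr1n.
  by rewrite -subr_le0 -zRe mul0r sub0r oppr_le0 -expr2 sqr_ge0.
have w_neq0 : w != 0.
  by apply: contraTneq e1w => ->; rewrite mulr0 -ltNge.
have e1_neq0 : e1 != 0.
  by apply: contraTneq e1w => ->; rewrite mulr0 mul0r -ltNge.
have w_gt0 : 0 < w by rewrite lt_neqAle eq_sym w_neq0.
have c0 : c = 0.
  have : 4 * e1 * c * kappa = 0 by rewrite -[LHS]opprK -zIm; ring.
  move/eqP; rewrite !mulf_eq0 pnatr_eq0 (negbTE e1_neq0) /= => /orP[/eqP//|].
  by move=> /eqP k0; move: w_neq0; rewrite /w k0 mulr0 normr0 eqxx.
(* With c = 0 the square zeta^2 = 1 - (2 eps w)^2 vanishes here. *)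
pose e2 := (2 * w)^-1.
have e2_eps0 : 0 <= e2 <= eps0.
  apply/andP; split; first by rewrite invr_ge0 mulr_ge0.
  apply: le_trans (le_trans e1_le eps_le).
  by rewrite /e2 -[leLHS]mul1r ler_pdivrMr ?mulr_gt0 // mulrCA mulrA.
have := z_sqr e2 e2_eps0.
rewrite zeta_sqr_parts -/w c0 mulr0 mul0r oppr0 /e2.
have -> : 2 * (2 * w)^-1 * w = 1 by field.
rewrite expr1n subrr => /eqP; rewrite (expf_eq0 _ 2) /= => /eqP ze2.
by have := z_ge e2 e2_eps0; rewrite /e2 ze2 normc0 leNgt gamma_gt0.
Qed.

(** * The uniform one-step estimate *)

Lemma is_norm_mulmx_le {R : realType} {n : nat} (N : 'cV[R[i]]_n -> R) :
  is_norm N -> exists2 C : R, 0 <= C &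
  forall (M : 'M[R[i]]_n) b, 0 <= b ->
    (forall i j, normc (M i j) <= b) ->
    forall x, N (M *m x) <= C * b * N x.
Proof.
move=> hN; have [C C0 coordC] := coord_le_norm N hN.
pose E := \sum_i N (delta_mx i ord0).
exists (C * E * n%:R).
  by rewrite mulr_ge0 // mulr_ge0 // sumr_ge0 // => i _; exact: is_norm_ge0.
move=> M b b0 Mb x; apply: le_trans (is_norm_le_coord N hN _) _.
have -> : C * E * n%:R * b * N x =
    \sum_i b * (C * N x) * n%:R * N (delta_mx i ord0).
  by rewrite -mulr_sumr -/E; move: E (n%:R) => E' n'; ring.
apply: ler_sum => i _; apply: ler_wpM2r; first exact: is_norm_ge0.
rewrite mxE; apply: (@le_trans _ _ (\sum_j normc (M i j * x j ord0))).
  elim/big_ind2 : _ => //; first by rewrite normc0.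
  by move=> x1 x2 y1 y2 h1 h2; apply: le_trans (le_normcD _ _) (lerD h1 h2).
rewrite mulr_natr -[n in leRHS]card_ord -sumr_const; apply: ler_sum => j _.
by rewrite normcM ler_pM ?normc_ge0.
Qed.

(** On the range of Pi_s, which is a line, both the projected step and the
exponential act as scalars; w is the value of exp (h l). *)
Lemma one_step_defectE {R : realType} (a c eps h : R) (d z : R[i])
    (U : 'cV[R[i]]_2) :
  eps%:C != 0 -> z != 0 -> 1 + z != 0 ->
  z ^+ 2 = 1 - 4 * eps%:C * c%:C * d + 4 * eps%:C ^+ 2 * a%:C ^+ 2 * d ^+ 2 ->
  stage_det c eps d h 2^-1 8^-1 != 0 -> stage_det c eps d h 1 6^-1 != 0 ->
  range (mulmx (Pi_s a c eps d z)) U ->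
  exists w : R[i],
   series (exp_terms (h%:C * lambda_s a c eps d z)) @ \oo --> (w : R[i]^o) /\
   Pi_s a c eps d z *m base_step h (JX_A a d) (JX_B c eps) *m U
     - expmx (h%:C *: JX_L a c eps d) *m U =
   (\sum_(k < 5) exp_terms (h%:C * lambda_s a c eps d z) k - w
     + h%:C ^+ 5 * slow_defect a c eps d z h) *: U.
Proof.
move=> e0 z0 z1 zsq D1 D2 [V _ <-].
set l := lambda_s a c eps d z; set Pi := Pi_s a c eps d z.
have [w cw] := cvg_series_exp_terms (h%:C * l).
have [w' cw'] := cvg_series_exp_terms (h%:C * (- eps%:C^-1 - l)).
exists w; split => //.
rewrite Pi_s_rank_one //; set t := slow_coord _ _ _ _ _ _.
have PP : Pi *m Pi = Pi by exact: Pi_s_idem.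
have -> : expmx (h%:C *: JX_L a c eps d) = w *: Pi + w' *: (1%:M - Pi).
  rewrite -(expmx_spectral Pi _ _ w w' PP cw cw'); congr expmx.
  rewrite (JX_L_spectral a c eps d z) // -/l -/Pi.
  by move: (Pi) => Q; rewrite scalerDr !scalerA.
rewrite -!scalemxAr -scalerBr [RHS]scalerA [_ * t]mulrC -[RHS]scalerA.
congr (t *: _).
have -> : (w *: Pi + w' *: (1%:M - Pi)) *m slow_vec a c eps d z =
    w *: slow_vec a c eps d z.
  have := Pi_s_slow_vec a c eps d z z0 z1 zsq; rewrite -/Pi.
  move: (Pi) (slow_vec _ _ _ _ _) => Q r Qr.
  by rewrite mulmxDl -!scalemxAl mulmxBl mul1mx Qr subrr scaler0 addr0.
rewrite -mulmxA Pi_s_rank_one // slow_coord_base_step // -/l.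
by rewrite -scalerBl addrAC.
Qed.

Section UniformStep.
Context {R : realType} (N : 'cV[R[i]]_2 -> R) (a c kappa eps0 h0 gamma : R)
  (z : R -> R[i]).
Local Notation d := (0 +i* kappa : R[i]).
Hypothesis hN : is_norm N.
Hypothesis gamma_gt0 : 0 < gamma.
Hypothesis z_ge : forall eps, 0 < eps <= eps0 -> gamma <= normc (z eps).
Hypothesis z_Re : forall eps, 0 < eps <= eps0 -> 0 < complex.Re (z eps).
Hypothesis z_sqr : forall eps, 0 < eps <= eps0 -> z eps ^+ 2 =
  1 - 4 * eps%:C * c%:C * d + 4 * eps%:C ^+ 2 * a%:C ^+ 2 * d ^+ 2.
Local Notation Pi eps := (Pi_s a c eps d (z eps)).

(** The norm enters only by homogeneity here, because the defect is a scalar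
multiple of U. *)
Lemma slow_step_uniform : exists C : R,
  forall eps h : R, 0 < eps <= eps0 -> 0 < h <= h0 ->
  forall U : 'cV[R[i]]_2, range (mulmx (Pi eps)) U ->
    N (Pi eps *m base_step h (JX_A a d) (JX_B c eps) *m U
       - expmx (h%:C *: JX_L a c eps d) *m U) <= C * h ^+ 5 * N U.
Proof.
have /ubounded_normc[Lam lamb] :=
  ubounded_lambda_s a c kappa eps0 h0 z z_Re.
have /ubounded_normc[Eta etab] :=
  ubounded_slow_defect a c kappa eps0 h0 gamma z gamma_gt0 z_ge z_Re z_sqr.
exists (Lam ^+ 5 * expR (h0 * Lam) + Eta) => eps h He Hh U PU.
have /andP[e0 _] := He; have /andP[h_gt0 hh] := Hh.
have zne0 : z eps != 0.
  by apply: contraTneq (z_Re _ He) => ->; rewrite ltxx.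
have z1ne0 : 1 + z eps != 0.
  apply: contraTneq (z_Re _ He) => /eqP; rewrite addrC addr_eq0 => /eqP ->.
  by rewrite -leNgt /= oppr_le0.
have en0 : eps%:C != 0 by rewrite (fmorph_eq0 (real_complex R)) gt_eqF.
have D1 : stage_det c eps d h 2^-1 8^-1 != 0.
  by rewrite !natrV_complex; apply: stage_det_neq0; rewrite ?invr_gt0.
have D2 : stage_det c eps d h 1 6^-1 != 0.
  by rewrite !natrV_complex; apply: stage_det_neq0; rewrite ?invr_gt0.
have [w [cw ->]] := one_step_defectE a c eps h d (z eps) U en0 zne0 z1ne0
  (z_sqr _ He) D1 D2 PU.
rewrite is_normZ //; apply: ler_wpM2r; first exact: is_norm_ge0.
apply: le_trans (le_normcD _ _) _; rewrite mulrDl.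
have Dt : regime eps0 h0 (eps, h) by [].
have lam_le := lamb _ Dt; have eta_le := etab _ Dt; rewrite /= in lam_le eta_le.
apply: lerD; last first.
  rewrite normcM normcX normc_real gtr0_norm // mulrC.
  by rewrite ler_wpM2r ?exprn_ge0 // ltW.
rewrite -normcN opprB; apply: le_trans (exp_remainder _ _ _ cw) _.
rewrite normcM normc_real gtr0_norm //.
have lam_ge0 := normc_ge0 (lambda_s a c eps d (z eps)).
move: (normc _) lam_ge0 lam_le => x x_ge0 x_le.
have Lam_ge0 : 0 <= Lam := le_trans x_ge0 x_le.
rewrite exprMn -mulrA mulrC; apply: ler_wpM2r; first by rewrite exprn_ge0 ?ltW.
apply: ler_pM; rewrite ?exprn_ge0 ?expR_ge0 ?lerXn2r ?nnegrE //.
by rewrite ler_expR ler_pM // ltW.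
Qed.

Lemma Pi_s_norm_uniform : exists2 C : R, 0 <= C &
  forall eps, 0 < eps <= eps0 -> forall x, N (Pi eps *m x) <= C * N x.
Proof.
have [C C0 CM] := is_norm_mulmx_le N hN.
have /choice[b Pib] : forall ij : 'I_2 * 'I_2, exists b : R,
    forall t, regime eps0 1 t -> normc (Pi t.1 ij.1 ij.2) <= b.
  move=> ij; apply/ubounded_normc.
  exact: ubounded_Pi_s gamma_gt0 z_ge z_Re _ _.
have b_ge0 : 0 <= \sum_ij `|b ij| by apply: sumr_ge0.
exists (C * \sum_ij `|b ij|); first exact: mulr_ge0.
move=> eps He; apply: CM => // i j.
have Dt : regime eps0 1 (eps, 1) by split => //=; rewrite ltr01 lexx.
apply: le_trans (Pib (i, j) _ Dt) _; apply: le_trans (ler_norm _) _.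
by rewrite (bigD1 (i, j)) //= lerDl sumr_ge0.
Qed.
End UniformStep.

Theorem corollary5p5 (R : realType)
    (N : 'cV[R[i]]_2 -> R) (hN : is_norm N)
    (a c : R) (hac : c ^+ 2 < a ^+ 2)
    (K eps0 h0 : R) (hK : 0 < K) (heps0 : 0 < eps0) (hh0 : 0 < h0)
    (zeta : R -> R[i] -> R[i])
    (hzeta : forall kappa : R, `|kappa| <= K ->
       zeta_branch a c eps0 (0 +i* kappa) (fun eps => zeta eps (0 +i* kappa)))
    (hgamma : exists2 gamma : R, 0 < gamma &
       forall kappa eps : R, `|kappa| <= K -> 0 <= eps <= eps0 ->
         gamma <= Normc.normc (zeta eps (0 +i* kappa)))
    (kappa : R) (hkappa : `|kappa| <= K) :
  let d : R[i] := 0 +i* kappa in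
  let A := JX_A a d in
  let B eps := JX_B c eps in
  let L eps := JX_L a c eps d in
  let S eps h := base_step h A (B eps) in
  let Pi eps := Pi_s a c eps d (zeta eps d) in
  (ereal_sup [set (h ^- 5)%:E *
                  opnorm N (Pi eps *m S eps h *m Pi eps
                            - expmx (h%:C *: L eps) *m Pi eps)
             | eps in `]0%R, eps0] & h in `]0%R, h0]] < +oo)%E
  /\
  exists C : R, forall eps h : R, 0 < eps <= eps0 -> 0 < h <= h0 ->
    forall U : 'cV[R[i]]_2, range (mulmx (Pi eps)) U ->
      N (Pi eps *m S eps h *m U - expmx (h%:C *: L eps) *m U)
      <= C * h ^+ 5 * N U.
Proof.
move=> d A B L S Pi.
have [gamma gamma_gt0 zeta_ge] := hgamma.
pose z eps := zeta eps d.
have closed_of eps : 0 < eps <= eps0 -> 0 <= eps <= eps0.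
  by case/andP => /ltW ->.
have z_ge eps : 0 < eps <= eps0 -> gamma <= normc (z eps).
  by move=> /closed_of; exact: zeta_ge.
have z_Re eps : 0 < eps <= eps0 -> 0 < complex.Re (z eps).
  move=> /closed_of; apply: zeta_branch_Re_gt0 (hzeta _ hkappa) gamma_gt0 _ _.
  by move=> e; exact: zeta_ge.
have z_sqr eps : 0 < eps <= eps0 -> z eps ^+ 2 =
    1 - 4 * eps%:C * c%:C * d + 4 * eps%:C ^+ 2 * a%:C ^+ 2 * d ^+ 2.
  by move=> /closed_of; case: (hzeta _ hkappa) => _ + _; apply.
have [C step] := slow_step_uniform N a c kappa eps0 h0 gamma z hN gamma_gt0
  z_ge z_Re z_sqr.
have [P P_ge0 PiP] := Pi_s_norm_uniform N a c kappa eps0 gamma z hN gamma_gt0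
  z_ge z_Re.
split; last by exists C.
(* The absolute value keeps the bound monotone in N U; C may be negative. *)
apply: (@le_lt_trans _ _ (`|C| * P)%:E); last exact: ltry.
apply: ge_ereal_sup => _ [eps /= + [h /= + <-]].
rewrite !in_itv /= => He Hh.
have /andP[h_gt0 _] := Hh.
have h5_gt0 : 0 < h ^+ 5 by rewrite exprn_gt0.
have -> : (`|C| * P)%:E = ((h ^- 5)%:E * (`|C| * P * h ^+ 5)%:E)%E.
  by rewrite -EFinM [in RHS]mulrC mulfK // gt_eqF.
apply: lee_wpmul2l; first by rewrite lee_fin invr_ge0 ltW.
apply: ge_ereal_sup => _ [x /= x1 <-]; rewrite lee_fin.
(* The operator at x is the eigenspace estimate at U = Pi x. *)
rewrite mulmxBl -![_ *m Pi eps *m x]mulmxA.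
have Ux : range (mulmx (Pi eps)) (Pi eps *m x) by exists x.
apply: le_trans (step _ _ He Hh _ Ux) _.
apply: (@le_trans _ _ (`|C| * h ^+ 5 * N (Pi eps *m x))).
  by rewrite !ler_wpM2r ?is_norm_ge0 ?ler_norm // ltW.
rewrite [leRHS]mulrAC; apply: ler_wpM2l; first by rewrite mulr_ge0 // ltW.
apply: le_trans (PiP _ He x) _.
by rewrite -[leRHS]mulr1 ler_wpM2l.
Qed.
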